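(* Let $G$ be a finite graph and $p\geq k\geq 2$ integers. If the tree-width of $G$ is at least $2(k-1)(p+1)$, then some minor of $G$ contains a $(<\!k)$-inseparable independent set of size $p$.
   Context: For $k\in\mathbb N$, a set $X$ of at least $k$ vertices of a graph is $(<\!k)$-inseparable if no two vertices of $X$ can be separated in the graph by deleting fewer than $k$ vertices (i.e. for $x,y\in X$ and any vertex set $S$ not containing $x,y$ with $|S|<k$, $x$ and $y$ lie in the same component after deleting $S$). *)

(* Defs.v *)
From mathcomp Require Import all_boot.
From mathcomp Require Import boolp.

Set Implicit Arguments.
Unset Strict Implicit.
Unset Printing Implicit Defensive.

Record sgraph := SGraph {
  vertex :> finType;
  adj : rel vertex;
  adj_sym : symmetric adj;
  adj_irrefl : irreflexive adj }.

Definition linked_in (G : sgraph) (A : {set G}) : rel G :=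
  connect [rel x y | [&& x \in A, y \in A & adj x y]].

(* The empty set counts as connected; nonemptiness is required separately. *)
Definition connected_in (G : sgraph) (A : {set G}) : Prop :=
  {in A &, forall x y, linked_in A x y}.

(* Cyclic sequences of length 2 are edges traversed back and forth. *)
Definition acyclic (G : sgraph) : Prop :=
  forall c : seq G, ucycle (@adj G) c -> size c < 3.

Definition is_tree (G : sgraph) : Prop :=
  [/\ 0 < #|G|, connected_in [set: G] & acyclic G].

Definition tree_decomposition (G D : sgraph) (bag : D -> {set G}) : Prop :=
  [/\ is_tree D,
      forall v : G, exists d : D, v \in bag d,
      forall u v : G, adj u v -> exists d : D, (u \in bag d) && (v \in bag d)
    & forall v : G, connected_in [set d | v \in bag d]].

(* Truncated predecessor: the graph without vertices gets width 0, not -1. *)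
Definition width (G D : sgraph) (bag : D -> {set G}) : nat :=
  (\max_(d : D) #|bag d|).-1.

Definition has_tree_decomposition_of_width (G : sgraph) (w : nat) : Prop :=
  exists (D : sgraph) (bag : D -> {set G}),
    tree_decomposition bag /\ width bag = w.

Lemma ex_tree_decomposition (G : sgraph) :
  exists w : nat, `[< has_tree_decomposition_of_width G w >].
Proof.
have sym0 : symmetric (fun _ _ : unit => false) by [].
have irr0 : irreflexive (fun _ : unit => fun _ => false) by [].
pose D := SGraph sym0 irr0; pose bag (_ : D) := [set: G].
exists (width bag); apply/asboolP; exists D, bag; split=> //.
have conn1 (A : {set D}) : connected_in A.
  by move=> [] [] _ _; exact: connect0.
split=> //.
- split=> //; first by rewrite card_unit.
  by case=> [|[] [|[] c]].
- by move=> v; exists tt; rewrite inE.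
- by move=> u v _; exists tt; rewrite !inE.
Qed.

Definition treewidth (G : sgraph) : nat := ex_minn (ex_tree_decomposition G).

(* H is a minor of G up to isomorphism, [branch] giving the branch sets. *)
Definition minor (H G : sgraph) : Prop :=
  exists branch : H -> {set G},
    [/\ forall x : H, branch x != set0,
        forall x : H, connected_in (branch x),
        forall x y : H, x != y -> [disjoint branch x & branch y]
      & forall x y : H, adj x y ->
          exists u v : G, [&& u \in branch x, v \in branch y & adj u v]].

Definition independent (G : sgraph) (X : {set G}) : Prop :=
  {in X &, forall x y, ~~ adj x y}.

Definition inseparable (k : nat) (G : sgraph) (X : {set G}) : Prop :=
  k <= #|X| /\
  {in X &, forall x y, forall S : {set G},
    x \notin S -> y \notin S -> #|S| < k -> linked_in (~: S) x y}.

(* Main.v *)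
Require Import Defs.
From mathcomp Require Import all_boot.
From mathcomp Require Import boolp.
From mathcomp Require Import zify.

(* If no minor is as required, a tree-decomposition of small width is built
   greedily. Put h = 2(k-1)(p-1) + k, and let U be the union of the bags chosen
   so far. For every component C of G - U we maintain that its neighbourhood
   N(C) lies in one bag, has at most h vertices, and is contained in a binary
   tree in G - C in which every vertex of N(C) has at most one child. If
   |N(C)| < h, add one vertex of C to N(C) to form the next bag, and to the
   tree. If |N(C)| = h, the tree splits into p disjoint connected sets with at
   least k vertices of N(C) each. Contract these, delete the edges between them,
   and keep C. If the p contracted vertices are not (<k)-inseparable in this
   minor, then fewer than k vertices separate two sets Y, Z of at least k
   vertices of N(C) through C. With S a smallest separator, N(C) together with
   the part of S in C is the next bag. A new component inside C misses Y - S or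
   Z - S, say Y - S, so it has at most |N(C)| - |Y| + |S| < h neighbours, and
   Menger's paths from Y to S extend the tree to them. The final width is at
   most h + k - 2. *)

Set Implicit Arguments.
Unset Strict Implicit.
Unset Printing Implicit Defensive.

(** * Menger's theorem *)

Section Menger.
Variable T : finType.
Implicit Types (e : rel T) (A B S : {set T}).

(** Trivial paths count, so a separator contains [A :&: B]. It may use vertices of [A] and [B], and
    paths follow the direction of [e]. *)
Definition separates e A B S : Prop :=
  forall a p, a \in A -> path e a p -> last a p \in B -> has (mem S) (a :: p).

(* The path ending in [b] is [f b :: g b]. *)
Definition linkage e A B (f : T -> T) (g : T -> seq T) : Prop :=
  (forall b, b \in B ->
     [/\ f b \in A, path e (f b) (g b), last (f b) (g b) = b
       & uniq (f b :: g b)]) /\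
  {in B &, forall b c x,
     x \in f b :: g b -> x \in f c :: g c -> b = c}.

Lemma path_to_hit e (P : {set T}) a p : path e a p -> has (mem P) (a :: p) ->
  exists q r, [/\ p = q ++ r, last a q \in P & ~~ has (mem P) (belast a q)].
Proof.
elim: p a => [|b p IH] a /=.
  by rewrite orbF => _ aP; exists [::], [::].
case/andP=> eab ebp; case: (boolP (a \in P)) => aP /=.
  by move=> _; exists [::], (b :: p).
move=> /(IH _ ebp) [q [r [-> lq hq]]].
by exists (b :: q), r; rewrite /= negb_or aP.
Qed.

Lemma path_from_hit e (P : {set T}) a p : path e a p -> has (mem P) (a :: p) ->
  exists c q r, [/\ a :: p = q ++ c :: r, path e c r, last c r = last a p,
                    c \in P & ~~ has (mem P) r].
Proof.
elim: p a => [|b p IH] a eap.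
  by rewrite /= orbF => aP; exists a, [::], [::].
case: (boolP (has (mem P) (b :: p))) => hP.
  move: eap => /= /andP[eab ebp] _.
  have [c [q [r [E pr lr cP hr]]]] := IH _ ebp hP.
  by exists c, (a :: q), r; rewrite E.
case/orP=> [aP|]; last by rewrite -/(has _ (b :: p)) (negbTE hP).
by exists a, [::], (b :: p).
Qed.

Lemma sub_linkage e1 e2 A B f g :
  subrel e1 e2 -> linkage e1 A B f g -> linkage e2 A B f g.
Proof.
move=> sub_e [lnk dsj]; split=> // b /lnk[fA fp fl fu].
by split=> //; apply: sub_path fp.
Qed.

Lemma exists_subset_card A n : n <= #|A| ->
  exists2 B : {set T}, B \subset A & #|B| = n.
Proof.
case/card_geqP=> s [us ss sA]; exists [set:: s].
  by apply/subsetP=> x; rewrite inE => /sA.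
by rewrite -ss -(card_uniqP us); apply: eq_card => x; rewrite inE.
Qed.

Definition del_edge e x y : rel T := fun u v => e u v && ((u, v) != (x, y)).

Lemma del_edge_sub e x y : subrel (del_edge e x y) e.
Proof. by move=> u v /andP[]. Qed.

Lemma path_del_edge_src e x y a p :
  path e a p -> x \notin belast a p -> path (del_edge e x y) a p.
Proof.
elim: p a => [|b p IH] a //= /andP[eab ebp].
rewrite inE negb_or => /andP[xa xp]; rewrite IH // andbT /del_edge eab /=.
by apply: contra xa => /eqP[->].
Qed.

Lemma path_del_edge_tgt e x y a p :
  path e a p -> y \notin p -> path (del_edge e x y) a p.
Proof.
elim: p a => [|b p IH] a //= /andP[eab ebp].
rewrite inE negb_or => /andP[yb yp]; rewrite IH // andbT /del_edge eab /=.
by apply: contra yb => /eqP[_ ->].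
Qed.

Section Glue.
Variables (e : rel T) (A B S B' : {set T}) (x y : T).
Variables (f1 f2 : T -> T) (g1 g2 : T -> seq T).
Let e' := del_edge e x y.
Hypotheses (exy : e x y) (xS : x \notin S) (B'B : B' \subset B).
Hypothesis sepS : separates e' A B S.
Hypothesis lnk1 : linkage e' A (x |: S) f1 g1.
Hypothesis lnk2 : linkage e' (y |: S) B' f2 g2.
Hypothesis onto : y |: S = f2 @: B'.

(** The first path up to [w], continued by the second path from [w] on, leads from [A] to [B] along
    [e'] and so meets [S]. By disjointness of the linkages, [S] is met by the first path only at its
    end [s] and by the second only at its start. A meeting strictly after [w] would repeat that
    start; hence it is at [s], and simplicity forces [w = s]. *)
Lemma glue_meet s b w : s \in x |: S -> b \in B' ->
  w \in f1 s :: g1 s -> w \in f2 b :: g2 b -> [/\ w = s, w = f2 b & w \in S].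
Proof.
move=> sP bB' w1 w2.
have [f1A f1p f1l f1u] := lnk1.1 s sP; have [f2A f2p f2l f2u] := lnk2.1 b bB'.
have endS t : t \in S -> t \in f1 s :: g1 s -> t = s.
  move=> tS t1; have tP : t \in x |: S by rewrite inE tS orbT.
  have [_ _ tl _] := lnk1.1 t tP; apply: (lnk1.2 t s tP sP t) => //.
  by rewrite -{1}tl mem_last.
have startS t : t \in S -> t \in f2 b :: g2 b -> t = f2 b.
  move=> tS t2; have : t \in y |: S by rewrite inE tS orbT.
  rewrite onto => /imsetP[c cB' E]; rewrite E; congr f2.
  by apply: (lnk2.2 c b cB' bB' t) => //; rewrite E mem_head.
suff wS : w \in S by split=> //; [apply: endS | apply: startS].
case/splitPl: w1 f1p f1l f1u endS => p1 p2 lp1.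
rewrite cat_path last_cat => /andP[pp1 pp2] lp2 u1 endS.
case/splitPl: w2 f2p f2l f2u startS => q1 q2 lq1.
rewrite cat_path last_cat => /andP[pq1 pq2] lq2 u2 startS.
have /hasP[t tpq tS] : has (mem S) (f1 s :: p1 ++ q2).
  apply: sepS => //; first by rewrite cat_path pp1 lp1 -lq1.
  by rewrite last_cat lp1 -lq1 lq2 (subsetP B'B).
move: tpq; rewrite -cat_cons mem_cat => /orP[t1|t2].
  have ts : t = s by apply: endS => //; rewrite -cat_cons mem_cat t1.
  suff p20 : p2 = [::] by rewrite -lp1; move: lp2; rewrite p20 /= => ->;
    rewrite -{1}ts.
  case: p2 lp2 u1 {endS} pp2 => [|c p2] //= lp2 u1 _.
  move: u1; rewrite -/(uniq (f1 s :: p1 ++ c :: p2)) -cat_cons cat_uniq.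
  case/and3P=> _ /negP[]; apply/hasP; exists s; last by rewrite ts in t1.
  by rewrite -lp2 mem_last.
have tb : t = f2 b by apply: startS => //; rewrite -cat_cons mem_cat t2 orbT.
by move: u2; rewrite /= mem_cat -tb t2 orbT.
Qed.

(** A second path starting at [y] is preceded by the first path ending at [x] and the edge [x -> y].
    Any other starts in [S], where a first path ends, and drops its repeated start. *)
Let sigma b := if f2 b == y then x else f2 b.
Let tail b := if f2 b == y then y :: g2 b else g2 b.

Lemma glue_linkage :
  linkage e A B' (fun b => f1 (sigma b)) (fun b => g1 (sigma b) ++ tail b).
Proof.
have sigmaP b : b \in B' -> sigma b \in x |: S.
  move=> bB'; have [/setU1P fQ _ _ _] := lnk2.1 b bB'.
  rewrite /sigma; case: eqP => [_|ny]; first exact: setU11.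
  by apply/setU1P; right; case: fQ.
have tailP b w : w \in tail b -> w \in f2 b :: g2 b.
  rewrite /tail; case: eqP => [->|_] //.
  by move=> wg; rewrite inE wg orbT.
have f2inj b c : b \in B' -> c \in B' -> f2 b = f2 c -> b = c.
  move=> bB' cB' E; apply: (lnk2.2 b c bB' cB' (f2 b)); first exact: mem_head.
  by rewrite E mem_head.
have sigmaS b : sigma b \in S -> sigma b = f2 b.
  by rewrite /sigma; case: eqP => // _; rewrite (negbTE xS).
have meet b c w : b \in B' -> c \in B' ->
    w \in f1 (sigma b) :: g1 (sigma b) -> w \in tail c -> b = c.
  move=> bB' cB' w1 /tailP w2.
  have [E1 E2 wS] := glue_meet (sigmaP b bB') cB' w1 w2.
  by apply: f2inj => //; rewrite -E2 -sigmaS -E1.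
split=> [b bB' | b c bB' cB' w].
  have [f1A f1p f1l f1u] := lnk1.1 _ (sigmaP b bB').
  have [f2A f2p f2l f2u] := lnk2.1 b bB'.
  have sube := @del_edge_sub e x y.
  split=> //.
  - rewrite cat_path (sub_path sube f1p) f1l /= /sigma /tail.
    case: eqP => [E|_] /=; last exact: sub_path f2p.
    by rewrite exy -E (sub_path sube f2p).
  - rewrite last_cat f1l /sigma /tail.
    by case: eqP => [E|_] /=; rewrite -?E.
  - rewrite -cat_cons cat_uniq f1u /=; apply/andP; split.
      apply/hasPn=> w w2; apply/negP=> w1.
      have [E1 E2 wS] := glue_meet (sigmaP b bB') bB' w1 (tailP _ _ w2).
      move: w2; rewrite /tail; case: eqP => E.
        by move: E1 wS; rewrite /sigma E eqxx => ->; rewrite (negbTE xS).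
      by rewrite E2; move: f2u => /= /andP[/negbTE->].
    by rewrite /tail; case: eqP f2u => [->|_] //= /andP[].
rewrite -!cat_cons !mem_cat => /orP[w1|w1] /orP[w2|w2].
- have E := lnk1.2 _ _ (sigmaP b bB') (sigmaP c cB') w w1 w2.
  have [fbQ _ _ _] := lnk2.1 b bB'; have [fcQ _ _ _] := lnk2.1 c cB'.
  apply: f2inj => //; move: E fbQ fcQ; rewrite /sigma !inE.
  case: eqP => [->|nb]; case: eqP => [->|nc] //=.
    by move=> <-; rewrite (negbTE xS).
  by move=> ->; rewrite (negbTE xS).
- exact: meet w1 w2.
- by apply/esym; apply: meet w2 w1.
- exact: (lnk2.2 b c bB' cB' w (tailP _ _ w1) (tailP _ _ w2)).
Qed.

End Glue.

(* Goering's induction on the number of edges: if deleting the edge [x -> y]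
   creates a separator [S] with fewer than [n] vertices, then [x |: S] and
   [y |: S] have [n] vertices, and linkages from [A] to [x |: S] and from
   [y |: S] to [B] can be glued along [S] and [x -> y]. *)
Lemma menger e A B n : (forall S, separates e A B S -> n <= #|S|) ->
  exists (B' : {set T}) f g, [/\ B' \subset B, #|B'| = n & linkage e A B' f g].
Proof.
have [m] := ubnP #|[set q : T * T | e q.1 q.2]|.
elim: m => // m IH in e A B *; rewrite ltnS => lem minS.
case: (pickP (fun q : T * T => e q.1 q.2)) => [[x y] /= exy|e0]; last first.
  (* Without edges all paths are trivial, so [A :&: B] separates. *)
  have /exists_subset_card[B' B'AB cB'] : n <= #|A :&: B|.
    apply: minS => a [|b p] aA /=; last by rewrite (e0 (a, b)).
    by move=> _ aB; rewrite inE aA aB.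
  exists B', id, (fun=> [::]); split=> //.
    exact: subset_trans B'AB (subsetIr _ _).
  split=> [b /(subsetP B'AB)|b c _ _ x]; first by case/setIP.
  by rewrite !inE => /eqP-> /eqP.
pose e' := del_edge e x y.
have lt_e' : #|[set q : T * T | e' q.1 q.2]| < m.
  apply: leq_trans lem; apply: proper_card; apply/properP; split.
    by apply/subsetP=> q; rewrite !inE => /andP[].
  by exists (x, y); rewrite !inE //= /e' /del_edge exy eqxx.
case: (EM (forall S, separates e' A B S -> n <= #|S|)) => [minS'|].
  have [B' [f [g [B'B cB' lnk]]]] := IH _ _ _ lt_e' minS'.
  by exists B', f, g; split=> //; apply: sub_linkage lnk => u v /andP[].
move=> /existsNP[S] /not_implyP[sepS] /negP; rewrite -ltnNge => ltSn.
(* A path that avoids [x] cannot use the deleted edge; the same holds for [y] below. *)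
have sepX : separates e A B (x |: S).
  move=> a p aA pe lB; apply/negPn/negP=> nh.
  have xap : x \notin a :: p by apply: contra nh => xap; apply/hasP;
    exists x => //; apply: setU11.
  have /hasP[z zp zS] : has (mem S) (a :: p).
    apply: sepS => //; apply: path_del_edge_src => //.
    by apply: contra xap => /mem_belast.
  by case/negP: nh; apply/hasP; exists z => //; apply/setU1P; right.
have sepY : separates e A B (y |: S).
  move=> a p aA pe lB; apply/negPn/negP=> nh.
  have yap : y \notin a :: p by apply: contra nh => yap; apply/hasP;
    exists y => //; apply: setU11.
  have /hasP[z zp zS] : has (mem S) (a :: p).
    apply: sepS => //; apply: path_del_edge_tgt => //.
    by apply: contra yap; rewrite inE => ->; rewrite orbT.
  by case/negP: nh; apply/hasP; exists z => //; apply/setU1P; right.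
have := minS _ sepX; have := minS _ sepY; rewrite !cardsU1.
case: (boolP (y \in S)) => yS /=; first by rewrite leqNgt ltSn.
case: (boolP (x \in S)) => xS /=; first by move=> _; rewrite leqNgt ltSn.
move=> nS _; have cS : #|S|.+1 = n by apply/eqP; rewrite eqn_leq ltSn -add1n.
(* Up to its first vertex in [x |: S], a path does not use [x -> y], so [R] also separates [A] from
   [B] in [e]. For [minQ], take the part from the last vertex in [y |: S] on. *)
have minP R : separates e' A (x |: S) R -> n <= #|R|.
  move=> sepR; apply: minS => a p aA pe lB.
  have [q [r [E lq hq]]] := path_to_hit pe (sepX _ _ aA pe lB).
  move: pe; rewrite E cat_path => /andP[pq _].
  rewrite -cat_cons has_cat (sepR a q) //; apply: path_del_edge_src => //.
  by apply: contra hq => xq; apply/hasP; exists x => //; apply: setU11.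
have minQ R : separates e' (y |: S) B R -> n <= #|R|.
  move=> sepR; apply: minS => a p aA pe lB.
  have [c [q [r [-> pr lr cQ hr]]]] := path_from_hit pe (sepY _ _ aA pe lB).
  rewrite has_cat (sepR c r) ?orbT ?lr //; apply: path_del_edge_tgt => //.
  by apply: contra hr => yr; apply/hasP; exists y => //; apply: setU11.
have [P' [f1 [g1 [P'P cP' lnk1]]]] := IH _ _ _ lt_e' minP.
have [B' [f2 [g2 [B'B cB' lnk2]]]] := IH _ _ _ lt_e' minQ.
have EP : P' = x |: S by apply/eqP; rewrite eqEcard P'P cardsU1 xS cP' -cS /=.
rewrite {}EP in lnk1.
(* Both sides have [n] elements, so a second path starts at every vertex of [y |: S]. *)
have onto : y |: S = f2 @: B'.
  apply/esym/eqP; rewrite eqEcard; apply/andP; split.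
    by apply/subsetP=> _ /imsetP[b bB' ->]; case: (lnk2.1 b bB').
  rewrite card_in_imset ?cB' ?cardsU1 ?yS -?cS //.
  move=> b c bB' cB'' E; apply: (lnk2.2 b c bB' cB'' (f2 b)).
    exact: mem_head.
  by rewrite E mem_head.
by have lnk := glue_linkage exy xS B'B sepS lnk1 lnk2 onto; do 3!eexists;
  split; eauto.
Qed.

End Menger.

(** * Components and binary trees *)

Section Linked.
Variable G : sgraph.
Implicit Types (A B C U X : {set G}) (x y : G).

Lemma linked_in_sym A : symmetric (linked_in A).
Proof.
apply: sym_connect_sym => x y /=.
by rewrite (@adj_sym G) andbCA.
Qed.

Lemma linked_in_sub A B x y : A \subset B -> linked_in A x y -> linked_in B x y.
Proof.
move=> /subsetP AB; apply: connect_sub => u v /and3P[uA vA uv].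
by apply: connect1; rewrite /= !AB.
Qed.

Lemma linked_in_adj A x y : x \in A -> y \in A -> adj x y -> linked_in A x y.
Proof. by move=> xA yA xy; apply: connect1; rewrite /= xA yA. Qed.

Lemma linked_in_path A x y : x \in A -> linked_in A x y ->
  exists p, [/\ path (@adj G) x p, last x p = y & {subset x :: p <= A}].
Proof.
move=> xA /connectP[p pp ->]; exists p; split=> //.
  by apply: sub_path pp => u v /and3P[].
move=> z; rewrite inE => /predU1P[-> //|].
elim: p x pp {xA} => //= u p IH x /andP[/and3P[_ uA _] /IH pA].
by rewrite inE => /predU1P[->|/pA].
Qed.

Lemma star_connected A x : {in A, forall y, linked_in A x y} -> connected_in A.
Proof.
move=> xA y z /xA xy /xA xz; apply: connect_trans xz.
by rewrite -/(linked_in _ _ _) linked_in_sym.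
Qed.

Lemma connected_in1 x : connected_in [set x].
Proof. by move=> y z /set1P-> /set1P->; apply: connect0. Qed.

Lemma connected_in0 : connected_in (@set0 G).
Proof. by move=> y z; rewrite inE. Qed.

Definition nbhd C : {set G} := [set v | (v \notin C) && [exists u in C, adj u v]].

Lemma nbhdP C v :
  reflect (v \notin C /\ exists2 u, u \in C & adj u v) (v \in nbhd C).
Proof.
rewrite inE; apply: (iffP andP) => -[vC H]; split=> //.
  by case/exists_inP: H => u; exists u.
by case: H => u uC uv; apply/exists_inP; exists u.
Qed.

(** Maximality is expressed by the last clause: every neighbour of [C] is in [U]. *)
Definition component U C : Prop :=
  [/\ C != set0, connected_in C, [disjoint C & U] & nbhd C \subset U].

Lemma exists_component U v : v \notin U -> exists C, component U C.
Proof.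
move=> vU; pose C := [set w | linked_in (~: U) v w].
have CU w : w \in C -> w \notin U.
  rewrite inE => /connectP[p pp ->].
  elim: p v vU pp {C} => //= u p IH v vU /andP[/and3P[_ uU _] pp].
  by apply: IH pp; rewrite inE in uU.
exists C; split.
- by apply/set0Pn; exists v; rewrite inE; apply: connect0.
- apply: (@star_connected _ v) => w; rewrite inE => /connectP[p pp ->].
  have : v \in C by rewrite inE; apply: connect0.
  elim: p {1 2 3 4}v pp => [|u p IH] x /=; first by move=> _ _; apply: connect0.
  case/andP=> xu pp xC; have uC : u \in C.
    by move: xC; rewrite !inE => vx; apply: connect_trans vx (connect1 _).
  case/and3P: xu => _ _ xu.
  by apply: connect_trans (linked_in_adj xC uC xu) (IH _ _ _).
- by apply/pred0P=> w /=; apply/negP=> /andP[/CU/negP].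
- apply/subsetP=> w /nbhdP[wC [u uC uw]]; apply: contraNT wC => wU.
  have uU := CU _ uC; move: uC; rewrite !inE => vu.
  by apply: connect_trans vu (linked_in_adj _ _ uw); rewrite inE.
Qed.

(** A connected set avoiding [U] cannot leave [C], so [C'] lies in [C] as soon as it meets [C]. If
    it misses [C], it has no neighbour in [C] either, so its neighbours in [B] are already in
    [U]. *)
Lemma component_extend U B C C' : component U C -> B \subset C :|: nbhd C ->
  component (U :|: B) C' -> component U C' \/ C' \subset C.
Proof.
case=> C0 Cc CU NU BC [C'0 C'c C'U NC'].
case: (boolP [disjoint C' & C]) => [dis|/pred0Pn[x /andP[/= xC' xC]]].
  left; split=> //.
    by apply: disjointWr C'U; apply: subsetUl.
  apply/subsetP=> w wN; case/setUP: (subsetP NC' _ wN) => // wB.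
  case/setUP: (subsetP BC _ wB) => [wC|wN']; last exact: (subsetP NU).
  case/nbhdP: (wN) => wC' [u uC' uw].
  have uC : u \notin C by apply/negP=> uC; move/pred0P: dis => /(_ u) /=;
    rewrite uC uC'.
  have : u \in U.
    by apply: (subsetP NU); apply/nbhdP; split=> //; exists w;
      rewrite // adj_sym.
  by move=> uU; move/pred0P: C'U => /(_ u) /=; rewrite inE uC' uU.
right; apply/subsetP=> y yC'.
have [p [pp <- pC']] := linked_in_path xC' (C'c _ _ xC' yC').
elim: p x xC' xC pp pC' => //= u p IH x xC' xC /andP[xu pp] pC'.
have uC' : u \in C' by apply: pC'; rewrite !inE eqxx orbT.
apply: IH => //; last by move=> z zp; apply: pC'; rewrite inE zp orbT.
apply: contraTT uC' => uC; apply/negP=> uC'.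
have uU : u \in U by apply: (subsetP NU); apply/nbhdP; split=> //; exists x.
by move/pred0P: C'U => /(_ u) /=; rewrite inE uC' uU.
Qed.

End Linked.

Section BinaryTree.
Variable G : sgraph.
Implicit Types (X : {set G}) (u v x y : G).

Inductive btree := Empty | Node of G & btree & btree.

Implicit Types t l r : btree.

Fixpoint verts t : {set G} :=
  if t is Node u l r then u |: (verts l :|: verts r) else set0.

Definition broot t : option G := if t is Node u _ _ then Some u else None.

Definition attached u t : bool := if broot t is Some v then adj u v else true.

Definition is_empty t : bool := broot t == None.

(* [X] is the set of vertices at which the tree may still grow. *)
Fixpoint wf X t : bool :=
  if t is Node u l r then
    [&& u \notin verts l :|: verts r, [disjoint verts l & verts r],
        attached u l && attached u r, (u \in X) ==> is_empty l || is_empty r,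
        wf X l & wf X r]
  else true.

Lemma wf_sub X X' t : {in verts t, forall x, x \in X' -> x \in X} ->
  wf X t -> wf X' t.
Proof.
elim: t => //= u l IHl r IHr sX /and5P[un dis att emp /andP[wl wr]].
rewrite un dis att IHl ?IHr // ?andbT.
- by apply/implyP=> uX'; apply: (implyP emp); apply: sX => //; apply: setU11.
- by move=> x xr; apply: sX; rewrite !inE xr !orbT.
- by move=> x xl; apply: sX; rewrite !inE xl !orbT.
Qed.

Lemma wf_nodeC X u l r : wf X (Node u l r) = wf X (Node u r l).
Proof.
rewrite /= setUC disjoint_sym; congr [&& _, _, _, _ & _].
- by rewrite andbC.
- by rewrite orbC.
- by rewrite andbC.
Qed.

Lemma wf_replace X X' u l r l' v :
  wf X (Node u l r) -> v \notin verts (Node u l r) -> X' \subset v |: X ->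
  verts l' \subset v |: verts l -> wf X' l' -> attached u l' ->
  (u \in X' -> is_empty l' || is_empty r) -> wf X' (Node u l' r).
Proof.
rewrite /= => /and5P[un dis /andP[_ ar] _ /andP[wl wr]].
rewrite !inE !negb_or => /and3P[vu vl vr] sX' sl' wl' al' emp.
rewrite al' ar wl' /=; apply/and4P; split.
- move: un; rewrite !inE !negb_or => /andP[ul ->]; rewrite andbT.
  apply/negP=> /(subsetP sl'); rewrite !inE (negbTE ul) orbF => /eqP E.
  by rewrite E eqxx in vu.
- apply: disjointWl sl' _;
  rewrite disjoints_subset subUset sub1set inE vr -disjoints_subset; exact: dis.
- exact/implyP.
- apply: wf_sub wr => x xr /(subsetP sX'); rewrite !inE => /predU1P[E|//].
  by rewrite E (negbTE vr) in xr.
Qed.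

Lemma wf_leaf X v : wf X (Node v Empty Empty).
Proof.
by rewrite /wf /verts /attached /is_empty /= setU0 inE implybT disjoints_subset sub0set.
Qed.

(** As a vertex of [X], [y] has a free place for a child, where [v] becomes a leaf. Now [y] may have
    two children, so it has to leave [X]. *)
Lemma move_token X t y v : wf X t -> y \in X -> y \in verts t ->
  v \notin verts t -> adj y v ->
  exists t', [/\ broot t' = broot t, verts t' = v |: verts t
               & wf (v |: X :\ y) t'].
Proof.
move=> wt yX; have sX : v |: X :\ y \subset v |: X by apply: setUS;
  apply: subsetDl.
have yv (z : G) : z != v -> z \in v |: X :\ y -> (z != y) && (z \in X).
  by move=> /negbTE zv; rewrite !inE zv.
elim: t wt => [|u l IHl r IHr] wt; first by rewrite inE.
move=> yt vt yvadj.
have uv : u != v by apply: contraNneq vt => <-; apply: setU11.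
(* After swapping the children if necessary, the free place or [y] itself is on the left. *)
wlog yl : l r IHl IHr wt yt vt / (y == u) && is_empty l || (y \in verts l).
  move=> W; have [|yl] := boolP ((y == u) && is_empty l || (y \in verts l)).
    exact: W.
  have Ev : verts (Node u l r) = verts (Node u r l) by rewrite /= (setUC (verts l)).
  rewrite Ev in yt vt *; have wt' := wt; rewrite wf_nodeC in wt';
    apply: (W r l) => //.
  move: yl yt; rewrite !inE negb_or => /andP[yl /negbTE->]; rewrite orbF.
  case: eqP yl => [E|_] //= nl _.
  by case/and5P: wt => _ _ _ /implyP;
    rewrite -E yX (negbTE nl) => /(_ isT) /= ->.
case/orP: yl => [/andP[/eqP yu el]|yl].
  have ->: verts (Node u l r) = u |: (verts Empty :|: verts r) by case: (l) el.
  exists (Node u (Node v Empty Empty) r); split=> //=.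
    by rewrite !set0U setU0 setUCA.
  apply: (wf_replace (l' := Node v Empty Empty) wt vt sX) => //=.
  - by rewrite !setU0; apply: subsetUl.
  - exact: wf_leaf.
  - by rewrite /attached /= -yu.
  - by move/(yv _ uv); rewrite yu eqxx.
have wl : wf X l by case/and5P: wt => _ _ _ _ /andP[].
have vl : v \notin verts l by apply: contra vt => /= vl; rewrite !inE vl !orbT.
have [l' [rl' vl' wl']] := IHl wl yl vl yvadj.
exists (Node u l' r); split=> //=; first by rewrite vl' -setUA setUCA.
have /and5P[_ _ /andP[al _] emp _] := wt.
apply: (wf_replace wt vt sX) => //; first by rewrite vl'.
  by rewrite /attached rl'.
move=> /(yv _ uv)/andP[_ uX]; rewrite /is_empty rl'; exact: implyP emp uX.
Qed.

(* A deepest token can be duplicated: below it nothing needs to be kept. *)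
Lemma branch_token X t : wf X t -> ~~ [disjoint X & verts t] ->
  exists2 x, x \in X :&: verts t & forall v, v \notin verts t -> adj x v ->
  exists t', [/\ broot t' = broot t, verts t' \subset v |: verts t,
    v |: X :&: verts t \subset verts t' & wf (v |: X) t'].
Proof.
elim: t => [|u l IHl r IHr] wt Xt.
  by case/negP: Xt; rewrite disjoint_sym disjoints_subset sub0set.
(* Up to a swap, either the left subtree has a token and the induction goes there, or the root
   carries the only token. *)
wlog [Xl|[Xl Xr]] : l r IHl IHr wt Xt / ~~ [disjoint X & verts l] \/
    [disjoint X & verts l] /\ [disjoint X & verts r].
  move=> W; have [Xl|Xl] := boolP [disjoint X & verts l]; last first.
    by apply: W => //; left.
  have [Xr|Xr] := boolP [disjoint X & verts r].
    by apply: W => //; right.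
  have wt' := wt; rewrite wf_nodeC in wt'.
  have Ev : verts (Node u r l) = verts (Node u l r) by rewrite /= (setUC (verts r)).
  rewrite -Ev in Xt *; by apply: (W r l) => //; left.
- have /and5P[_ _ /andP[al _] emp /andP[wl _]] := wt.
  have [x /setIP[xX xl] xP] := IHl wl Xl.
  exists x => [|v vt xv]; first by rewrite !inE xX xl !orbT.
  have vl : v \notin verts l by apply: contra vt => /= vl;
    rewrite !inE vl !orbT.
  have [l' [rl' vl' Xl' wl']] := xP v vl xv.
  have uv : u != v by apply: contraNneq vt => <-; apply: setU11.
  exists (Node u l' r); split=> //=.
  + apply/subsetP=> z; rewrite !inE => /or3P[->|/(subsetP vl')|->];
    rewrite ?orbT //.
    by rewrite !inE => /orP[]->; rewrite ?orbT.
  + apply/subsetP=> z; have := subsetP Xl' z; rewrite !inE => zl'.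
    case/orP=> [zv|/andP[zX]]; first by rewrite zl' ?zv ?orbT.
    by case/or3P=> [->|zl|->]; rewrite ?orbT // zl' ?orbT // zX zl orbT.
  + apply: (wf_replace wt vt) => //; first by rewrite /attached rl'.
    rewrite !inE (negbTE uv) /= => uX; rewrite /is_empty rl';
      exact: implyP emp uX.
have ntl z : z \in X -> z \in verts (Node u l r) -> z = u.
  move=> zX /=; rewrite !inE => /or3P[/eqP //|zl|zr].
    by move/pred0P: Xl => /(_ z) /=; rewrite zX zl.
  by move/pred0P: Xr => /(_ z) /=; rewrite zX zr.
have uX : u \in X.
  by case/pred0Pn: Xt => z /= /andP[zX zt]; rewrite -(ntl z).
exists u => [|v vt uv]; first by rewrite inE uX setU11.
(* Everything below [u] is discarded. With [v] as its only child, [u] may keep its token. *)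
exists (Node u (Node v Empty Empty) Empty); split=> //=.
- apply/subsetP=> z; rewrite !inE !orbF => /orP[->|->]; rewrite ?orbT //.
- apply/subsetP=> z; rewrite !inE => /orP[->|/andP[zX zt]]; rewrite ?orbT //.
  by rewrite (ntl z) ?eqxx //= !inE.
- move: (wf_leaf (v |: X) v) => /= ->.
  rewrite /attached /is_empty /= !inE uv /= !setU0 disjoint_sym disjoints_subset sub0set.
  by rewrite eqxx implybT !orbF !andbT; apply: contraNneq vt => <-;
    apply: setU11.
Qed.

End BinaryTree.

(** * Splitting a binary tree into blocks *)

Section Split.
Variable G : sgraph.
Implicit Types (X R : {set G}) (u v x y : G) (t l r : btree G).

Lemma card_node X R R' u : u \notin R :|: R' -> [disjoint R & R'] ->
  #|(u |: (R :|: R')) :&: X| = (u \in X) + (#|R :&: X| + #|R' :&: X|).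
Proof.
move=> uR dRR';
  have cU (A B : {set G}) : [disjoint A & B] -> #|A :|: B| = #|A| + #|B|.
  by move=> dAB; apply/eqP; have := leq_card_setU A B; rewrite dAB => /leqifP.
rewrite !setIUl !cU.
- congr addn; case: (boolP (u \in X)) => uX.
    by rewrite (setIidPl _) ?sub1set ?cards1.
  by apply/eqP; rewrite cards_eq0 setI_eq0 disjoints_subset sub1set inE.
- by apply: disjointWl (subsetIl _ _) _; apply: disjointWr (subsetIl _ _) _.
- rewrite -setIUl; apply: disjointWl (subsetIl _ _) _.
  by apply: disjointWr (subsetIl _ _) _; rewrite disjoints_subset sub1set inE.
Qed.

(** The adjacency hypotheses are stated per vertex of [R] and [R'] so that an empty remainder
    requires no edge. *)
Lemma connected_node R R' u : connected_in R -> connected_in R' ->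
  (forall v, v \in R -> exists2 w, w \in R & adj u w) ->
  (forall v, v \in R' -> exists2 w, w \in R' & adj u w) ->
  connected_in (u |: (R :|: R')).
Proof.
move=> cR cR' uR uR'; apply: (@star_connected _ _ u) => y.
have uA : u \in u |: (R :|: R') by apply: setU11.
suff main (A : {set G}) : A \subset u |: (R :|: R') -> connected_in A ->
    (forall v, v \in A -> exists2 w, w \in A & adj u w) ->
    y \in A -> linked_in (u |: (R :|: R')) u y.
  case/setU1P=> [->|/setUP[]]; first exact: connect0.
    by apply: main => //; rewrite setUCA subsetUl.
  by apply: main => //; rewrite setUA subsetUr.
move=> sA cA uw yA; have [w wA adj_uw] := uw y yA.
apply: connect_trans (linked_in_sub sA (cA w y wA yA)).
by apply: linked_in_adj => //; apply: (subsetP sA).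
Qed.

(* [Bs] are the finished blocks, [R] the remainder at the root, from which a
   further block may be formed higher up. *)
Lemma split_tree k X t : 1 < k -> wf X t ->
  exists (Bs : seq {set G}) (R : {set G}),
  [/\ forall B, B \in Bs ->
        [/\ B \subset verts t, connected_in B & k <= #|B :&: X|],
      pairwise (fun A B : {set G} => [disjoint A & B]) Bs,
      [/\ R \subset verts t, connected_in R, #|R :&: X| < k
        & {in R, forall v, exists2 u, broot t = Some u & u \in R}],
      {in Bs, forall B : {set G}, [disjoint R & B]}
    & #|verts t :&: X| <= 2 * (k - 1) * size Bs + #|R :&: X|].
Proof.
move=> k1; elim: t => [|u l IHl r IHr] /=.
  exists [::], set0; split=> //; last by rewrite set0I cards0.
  split=> //; first exact: connected_in0.
    by rewrite set0I cards0 ltnW.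
  by move=> v; rewrite inE.
case/and5P=> un dis /andP[al ar] emp /andP[/IHl[Bl [Rl [Pl dl [sl cl kl rl] Rdl el]]]
  /IHr[Br [Rr [Pr dr [sr cr kr rr] Rdr er]]]].
have Rdis : [disjoint Rl & Rr] by apply: disjointWl sl _;
  apply: disjointWr sr _.
have uR : u \notin Rl :|: Rr by apply: contra un; apply/subsetP/setUSS.
have cross B B' : B \in Bl -> B' \in Br -> [disjoint B & B'].
  move=> /Pl[sB _ _] /Pr[sB' _ _].
  by apply: disjointWl sB _; apply: disjointWr sB' _.
pose R := u |: (Rl :|: Rr).
have cR : connected_in R.
  apply: connected_node => // v.
    by move/rl=> [w lw wR]; exists w => //; move: al; rewrite /attached lw.
  by move/rr=> [w rw wR]; exists w => //; move: ar; rewrite /attached rw.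
have sR : R \subset u |: (verts l :|: verts r) by rewrite setUS ?setUSS.
have PB B : B \in Bl ++ Br ->
    [/\ B \subset u |: (verts l :|: verts r), connected_in B & k <= #|B :&: X|].
  rewrite mem_cat => /orP[/Pl[sB cB kB]|/Pr[sB cB kB]]; split=> //.
    by apply: subset_trans sB _; rewrite setUCA subsetUl.
  by apply: subset_trans sB _; rewrite setUA subsetUr.
have dB : pairwise (fun A B : {set G} => [disjoint A & B]) (Bl ++ Br).
  rewrite pairwise_cat dl dr !andbT; apply/allrelP => B B'; exact: cross.
have RdB : {in Bl ++ Br, forall B : {set G}, [disjoint R & B]}.
  move=> B; rewrite mem_cat => BB.
  rewrite disjoints_subset !subUset sub1set -!disjoints_subset inE.
  case/orP: BB => BB.
    have [sB _ _] := Pl _ BB; rewrite (Rdl _ BB) /=; apply/andP; split.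
      by apply: contra un => /(subsetP sB) uB; rewrite inE uB.
    rewrite disjoint_sym; apply: disjointWl sB _; apply: disjointWr sr _;
      exact: dis.
  have [sB _ _] := Pr _ BB; rewrite (Rdr _ BB) andbT; apply/andP; split.
    by apply: contra un => /(subsetP sB) uB; rewrite inE uB orbT.
  by apply: disjointWl sl _; apply: disjointWr sB _; exact: dis.
have cardR : #|R :&: X| = (u \in X) + (#|Rl :&: X| + #|Rr :&: X|).
  exact: card_node.
have bound : #|verts l :&: X| + #|verts r :&: X| <=
    2 * (k - 1) * size (Bl ++ Br) + (#|Rl :&: X| + #|Rr :&: X|).
  by rewrite size_cat mulnDr addnACA leq_add.
have cardV : #|(u |: (verts l :|: verts r)) :&: X|
    = (u \in X) + (#|verts l :&: X| + #|verts r :&: X|) by apply: card_node.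
(* With fewer than [k] tokens [R] is passed on as the remainder; otherwise it is closed off as a
   block and the new remainder is empty. *)
case: (ltnP #|R :&: X| k) => kR.
  exists (Bl ++ Br), R; split=> //.
    by split=> // v _; exists u => //; apply: setU11.
  by rewrite cardV cardR [X in _ <= X]addnCA leq_add2l.
exists (R :: Bl ++ Br), set0; split=> //.
- by move=> B; rewrite inE => /predU1P[->|/PB].
- by rewrite /= dB andbT; apply/allP.
- split; rewrite ?sub0set ?set0I ?cards0 ?(ltnW k1) //;
  first exact: connected_in0.
  by move=> v; rewrite inE.
- by move=> B _; rewrite disjoints_subset sub0set.
rewrite cardV set0I cards0 addn0 /= mulnS.
apply: leq_trans (leq_add (leqnn _) bound) _; rewrite addnCA addnC leq_add2r.
clear -kl kr emp k1 sl sr.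
(* The closed block has at most [2 * (k - 1)] tokens. This is clear if [u] has none; otherwise one
   child is empty, and the block has at most [1 + (k - 1)] tokens, which suffices as [1 < k]. *)
case: (boolP (u \in X)) emp => /= uX; last by move=> _; lia.
have empR t R0 : is_empty t -> R0 \subset verts t -> #|R0 :&: X| = 0.
  by case: t => // _; rewrite /= subset0 => /eqP->; rewrite set0I cards0.
by case/orP=> [/empR/(_ sl)|/empR/(_ sr)] ->; lia.
Qed.

(** At most [p - 1] blocks and a remainder with at most [k - 1] tokens would not account for all of
    [X]. *)
Lemma split_blocks k p X t : 1 < k -> wf X t -> X \subset verts t ->
  2 * (k - 1) * (p - 1) + (k - 1) < #|X| ->
  exists B : 'I_p -> {set G},
  [/\ forall i, B i \subset verts t, forall i, connected_in (B i),
      forall i, k <= #|B i :&: X|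
    & forall i j, i != j -> [disjoint B i & B j]].
Proof.
move=> k1 wt Xt; have [Bs [R [PB dB [_ _ kR _] _]]] := split_tree k1 wt.
rewrite (setIidPr Xt) => cX hX.
have lt_p (i : 'I_p) : i < size Bs.
  apply: (leq_trans (ltn_ord i)); rewrite leqNgt; apply/negP=> lt_B.
  have : 2 * (k - 1) * size Bs <= 2 * (k - 1) * (p - 1) by rewrite leq_mul2l;
    lia.
  lia.
have PBi (i : 'I_p) := PB _ (mem_nth set0 (lt_p i)).
exists (fun i => nth set0 Bs i); split=> [i|i|i|i j ij]; try by case: (PBi i).
move/(pairwiseP set0): dB => dB.
case: (ltngtP i j) => [lij|lij|/val_inj E]; last by rewrite E eqxx in ij.
  by apply: dB; rewrite // inE lt_p.
by rewrite disjoint_sym; apply: dB; rewrite // inE lt_p.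
Qed.

End Split.

(** * The minor obtained by contracting the blocks *)

Section External.
Variable G : sgraph.
Implicit Types (C X Y Z S : {set G}) (u v x y : G).

(* Oriented from [Y] to [Z], so that only the ends of a [Y]-[Z] path can lie
   outside [C]. *)
Definition external C Y Z : rel G := fun u v =>
  [&& adj u v, u \in Y :|: C, v \in Z :|: C & (u \in C) || (v \in C)].

Lemma external_adj C Y Z : subrel (external C Y Z) (@adj G).
Proof. by move=> u v /and4P[]. Qed.

Lemma external_sym C Y Z u v : external C Y Z u v = external C Z Y v u.
Proof. by rewrite /external adj_sym orbC; congr (_ && _); rewrite andbCA. Qed.

Lemma separates_external_sym C Y Z S :
  separates (external C Y Z) Y Z S -> separates (external C Z Y) Z Y S.
Proof.
move=> sep z p zZ pp lY.
have := sep (last z p) (rev (belast z p)) lY.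
rewrite -rev_rcons -lastI has_rev; apply.
  by rewrite rev_path; apply: sub_path pp => u v; rewrite external_sym.
by case: p {pp lY} => //= b p; rewrite rev_cons last_rcons.
Qed.

(** An inner vertex is entered as a vertex of [Z :|: C] and left as one of [Y :|: C], hence lies in
    [C]. *)
Lemma external_path_sub C Y Z y p : [disjoint Y & Z] ->
  path (external C Y Z) y p -> last y p \in C -> p != [::] -> {subset p <= C}.
Proof.
move=> dYZ; elim: p y => //= u p IH y /andP[/and4P[_ _ uZC _] pp] lC _ x.
rewrite inE => /predU1P[->|]; last first.
  by case: p pp lC IH => // v p pp lC IH; apply: IH pp lC _ _.
case: p pp lC {IH} => //= v p /andP[/and4P[_ uYC _ _] _] _.
case/setUP: uYC => // uY; case/setUP: uZC => // uZ.
by rewrite (disjointFr dYZ uY) in uZ.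
Qed.

(** Otherwise a path through [C'] would join [y] to [z] and avoid [S]. *)
Lemma connected_one_side C C' Y Z S y z :
  C' \subset C -> connected_in C' -> [disjoint C' & S] ->
  separates (external C Y Z) Y Z S ->
  y \in Y -> y \in nbhd C' -> y \notin S ->
  z \in Z -> z \in nbhd C' -> z \in S.
Proof.
move=> sC cC' dS sep yY /nbhdP[yC [c cC cy]] yS zZ /nbhdP[zC [d dC dz]].
apply/negPn/negP=> zS.
have [p [pp lp pC]] := linked_in_path cC (cC' c d cC dC).
have pe : path (external C Y Z) y (c :: rcons p z).
  rewrite /= rcons_path lp /external adj_sym cy dz /= !inE yY zZ.
  rewrite (subsetP sC _ cC) (subsetP sC _ dC) ?orbT ?andbT /=.
  elim: p c pp pC {cC cy lp} => //= u p IH c /andP[cu pp] pC.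
  have cC := subsetP sC _ (pC c (mem_head _ _)).
  have uC : u \in C by apply/(subsetP sC)/pC; rewrite !inE eqxx orbT.
  rewrite /external cu !inE cC uC !orbT /=; apply: IH => // x xp.
  by apply: pC; rewrite inE xp orbT.
have lz : last y (c :: rcons p z) \in Z by rewrite /= last_rcons.
have /hasP[x xp /= xS] := sep y _ yY pe lz.
move: xp; rewrite inE -rcons_cons mem_rcons inE.
case/or3P=> [/eqP E|/eqP E|/pC xC'].
- by rewrite -E (xS : x \in S) in yS.
- by rewrite -E (xS : x \in S) in zS.
- by move: xS; rewrite (disjointFr dS xC').
Qed.

End External.

Section MeshMinor.
Variables (G : sgraph) (k p : nat) (C X : {set G}) (B : 'I_p -> {set G}).
Hypotheses (kp : k <= p) (cB : forall i, connected_in (B i)).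
Hypotheses (B0 : forall i, B i != set0) (BC : forall i, [disjoint B i & C]).
Hypothesis dB : forall i j : 'I_p, i != j -> [disjoint B i & B j].

Definition mesh_vertex : finType := ('I_p + {c | c \in C})%type.

(** Edges between contracted blocks are deleted, which makes the blocks independent and forces paths
    between them through [C]. *)
Definition mesh_adj (a b : mesh_vertex) : bool :=
  match a, b with
  | inl _, inl _ => false
  | inl i, inr c | inr c, inl i => [exists u in B i, adj u (val c)]
  | inr c, inr d => adj (val c) (val d)
  end.

Lemma mesh_adj_sym : symmetric mesh_adj.
Proof. by move=> [i|c] [j|d] //=; apply: adj_sym. Qed.

Lemma mesh_adj_irrefl : irreflexive mesh_adj.
Proof. by move=> [i|c] //=; apply: adj_irrefl. Qed.

Definition mesh_graph : sgraph := SGraph mesh_adj_sym mesh_adj_irrefl.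

Definition mesh_branch (a : mesh_graph) : {set G} :=
  match a with inl i => B i | inr c => [set val c] end.

Lemma mesh_graph_minor : minor mesh_graph G.
Proof.
exists mesh_branch; split.
- by case=> [i|c] //=; apply/set0Pn; exists (val c); apply: set11.
- by case=> [i|c] //=; apply: connected_in1.
- case=> [i|c] [j|d] //= ne.
  + by apply: dB; apply: contraNneq ne => ->.
  + by rewrite disjoint_sym disjoints_subset sub1set inE (disjointFl (BC i)) ?(valP d).
  + by rewrite disjoints_subset sub1set inE (disjointFl (BC j)) ?(valP c).
  + rewrite disjoints_subset sub1set !inE; apply: contraNneq ne => E.
    by rewrite (val_inj E).
- case=> [i|c] [j|d] //=.
  + by case/exists_inP=> u uB ud; exists u, (val d); rewrite uB set11.
  + by case/exists_inP=> u uB uc; exists (val c), u; rewrite uB set11 adj_sym.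
  + by move=> cd; exists (val c), (val d); rewrite !set11.
Qed.

(** If fewer than [k] vertices separate two contracted blocks in the mesh, those among them in [C]
    meet every external path between the two blocks, since such a path uses no third block. *)
Lemma inseparable_or_separator :
  (exists X' : {set mesh_graph},
     [/\ #|X'| = p, independent X' & inseparable k X']) \/
  exists (i j : 'I_p) (S : {set G}), [/\ i != j, #|S| < k
    & separates (external C (B i :&: X) (B j :&: X)) (B i :&: X) (B j :&: X) S].
Proof.
case: (EM (exists (i j : 'I_p) (S : {set G}), [/\ i != j, #|S| < k
    & separates (external C (B i :&: X) (B j :&: X)) (B i :&: X) (B j :&: X) S])).
  by right.
move=> nosep; left;
  pose X' : {set mesh_graph} := [set inl i | i in [set: 'I_p]].
have cX' : #|X'| = p by rewrite card_imset ?cardsT ?card_ord // => i j [].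
exists X'; split=> //.
  by move=> _ _ /imsetP[i _ ->] /imsetP[j _ ->].
split; first by rewrite cX'.
move=> _ _ /imsetP[i _ ->] /imsetP[j _ ->] S iS jS ltSk.
have [->|ij] := eqVneq i j; first exact: connect0.
apply: contrapT => nlink; apply: nosep.
pose S0 := [set val c | c : {c | c \in C} in [set c | inr c \in S]].
exists i, j, S0; split=> //.
  apply: leq_ltn_trans ltSk; apply: leq_trans (leq_imset_card _ _) _.
  have inj_inr : injective (@inr 'I_p {c | c \in C}) by move=> c d [].
  rewrite -(card_imset _ inj_inr).
  by apply: subset_leq_card; apply/subsetP=> _ /imsetP[c + ->]; rewrite inE.
move=> y q /setIP[yB _] pq /setIP[lB _]; apply/negPn/negP=> nh; apply: nlink.
(* The contraction map along an external path. Such a path stays in [B i], [B j] and [C], so the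
   default [inl j] is right for it. *)
pose phi u : mesh_graph := if insub u is Some c then inr c
  else if u \in B i then inl i else inl j.
have phiC u (uC : u \in C) : phi u = inr (Sub u uC) by rewrite /phi insubT.
have phii u : u \in B i -> phi u = inl i.
  by move=> uB; rewrite /phi insubF ?uB // (disjointFr (BC i)).
have phij u : u \in B j -> phi u = inl j.
  by move=> uB;
    rewrite /phi insubF ?(disjointFr (BC j)) // (disjointFl (dB ij)).
have phiS u : u \notin S0 -> (phi u \in ~: S).
  rewrite /phi inE; case: insubP => [c _ cu|_ _].
    by apply: contra => cS; apply/imsetP; exists c => //; rewrite inE.
  by case: ifP.
rewrite -(phii y yB) -(phij _ lB).
elim: q y pq {yB lB} nh => [|v q IH] u /=; first by move=> *; apply: connect0.
case/andP=> /and4P[uv uY vZ uvC] pq; rewrite negb_or => /andP[uS nh].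
apply: connect_trans (IH v pq nh); apply: linked_in_adj; first exact: phiS.
  by apply: phiS; move: nh; rewrite /= negb_or => /andP[].
case: (boolP (u \in C)) uvC => /= uC vC.
  rewrite (phiC u uC); case/setUP: vZ => [/setIP[vB _]|vC'].
    by rewrite (phij v vB) /=; apply/exists_inP; exists v; rewrite // adj_sym.
  by rewrite (phiC v vC').
rewrite (phiC v vC); move: uY; rewrite inE (negbTE uC) orbF => /setIP[uB _].
by rewrite (phii u uB) /=; apply/exists_inP; exists u.
Qed.

End MeshMinor.

(** * Extending the tree along a linkage *)

Section Tokens.
Variable G : sgraph.
Implicit Types (C X Y Z S : {set G}) (u v x y : G) (t : btree G).

Lemma move_token_along X t y p : wf X t -> X \subset verts t -> y \in X ->
  path (@adj G) y p -> uniq p -> {in p, forall x, x \notin verts t} ->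
  exists t', verts t' = verts t :|: [set:: p] /\ wf (last y p |: X :\ y) t'.
Proof.
elim: p X t y => [|v p IH] X t y wt Xt yX /=.
  move=> _ _ _; exists t; rewrite setD1K //; split=> //.
  by apply/setP=> x; rewrite !inE orbF.
case/andP=> yv pp /andP[vp up] pt.
have vt : v \notin verts t by apply: pt; apply: mem_head.
have [t1 [_ vt1 wt1]] := move_token wt yX (subsetP Xt y yX) vt yv.
have Xt1 : v |: X :\ y \subset verts t1.
  by rewrite vt1 setUS //; apply: subset_trans (subsetDl _ _) Xt.
have pt1 : {in p, forall x, x \notin verts t1}.
  move=> x xp; have := pt x; rewrite inE xp orbT => /(_ isT) xt.
  rewrite vt1 !inE negb_or xt andbT.
  by apply: contraNneq vp => <-.
have [t2 [vt2 wt2]] := IH _ _ _ wt1 Xt1 (setU11 _ _) pp up pt1.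
exists t2; split.
  by rewrite vt2 vt1; apply/setP=> x; rewrite !inE -orbA orbCA.
apply: wf_sub wt2 => x _; rewrite !inE => /predU1P[->|/andP[-> xX]].
  by rewrite eqxx.
case: eqVneq => [E|nE]; rewrite ?xX ?orbT //=; case: eqVneq => [E|_];
  rewrite ?orbT //.
by case/negP: vt; rewrite -E (subsetP Xt).
Qed.

(** The tokens travel one after another, from [f s] to [s]. Disjointness of the paths keeps the
    remaining tokens in place and the remaining paths off the grown tree. *)
Lemma move_tokens_along X t (L : seq G) (f : G -> G) (g : G -> seq G) :
  wf X t -> X \subset verts t -> uniq L ->
  {in L, forall s, [/\ f s \in X, path (@adj G) (f s) (g s),
     last (f s) (g s) = s, uniq (g s) & {in g s, forall x, x \notin verts t}]} ->
  {in L, forall s, s \in g s} ->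
  {in L &, forall s s' x, x \in f s :: g s -> x \in f s' :: g s' -> s = s'} ->
  exists t',
    [/\ forall x, (x \in verts t') = (x \in verts t) || has (fun s => x \in g s) L
      & wf ([set x in X | x \notin map f L] :|: [set:: L]) t'].
Proof.
elim: L X t => [|s L IH] X t wt Xt /=.
  exists t; split=> [x|]; first by rewrite orbF.
  by apply: wf_sub wt => x _; rewrite !inE orbF andbT.
case/andP=> sL uL PL gL dL.
have [fX fp fl fu ft] := PL s (mem_head _ _).
have [t1 [vt1 wt1]] := move_token_along wt Xt fX fp fu ft.
rewrite fl in wt1.
have sg := gL s (mem_head _ _).
have inL s' : s' \in L -> s' \in s :: L by rewrite inE => ->; rewrite orbT.
have neL s' x : s' \in L -> x \in f s :: g s -> x \notin f s' :: g s'.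
  move=> s'L xs; apply: contra sL => xs'.
  by rewrite (dL s s' (mem_head _ _) (inL _ s'L) x xs xs').
have Xt1 : s |: X :\ f s \subset verts t1.
  rewrite vt1; apply/subsetP=> x;
    rewrite !inE => /predU1P[->|/andP[_ /(subsetP Xt)->//]].
  by rewrite sg orbT.
have [|||t2 [vt2 wt2]] := IH _ _ wt1 Xt1 uL.
- move=> s' s'L; have [fX' fp' fl' fu' ft'] := PL s' (inL _ s'L); split=> //.
    rewrite !inE fX' andbT; apply/orP; right.
    by have := neL s' (f s) s'L (mem_head _ _);
      rewrite inE negb_or eq_sym => /andP[].
  move=> x xg; rewrite vt1 !inE negb_or ft' //=.
  apply: contraL (xg) => xs; have := neL s' x s'L;
    rewrite !inE xs orbT => /(_ isT).
  by rewrite negb_or => /andP[].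
- by move=> s' s'L; apply: gL; apply: inL.
- by move=> a b aL bL; apply: dL; apply: inL.
exists t2; split.
  by move=> x; rewrite vt2 vt1 !inE orbA.
apply: wf_sub wt2 => x _; rewrite !inE negb_or.
case/orP=> [/and3P[xX xf ->]|/orP[/eqP->|->]]; rewrite ?orbT //.
  by rewrite xX xf orbT.
rewrite eqxx /=; suff -> : s \notin map f L by [].
apply/negP=> /mapP[s' s'L E].
have [fX' _ _ _ _] := PL s' (inL _ s'L).
by have := ft s sg; rewrite E (subsetP Xt).
Qed.

(** The last vertex before entering [C] would be in [nbhd C]. *)
Lemma path_avoids C u p : path (@adj G) u p -> u \notin C ->
  {in belast u p, forall x, x \notin nbhd C} -> {in p, forall x, x \notin C}.
Proof.
elim: p u => //= v p IH u /andP[uv pp] uC uN.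
have vC : v \notin C.
  apply/negP=> vC; have := uN u (mem_head _ _); case/negP.
  by apply/nbhdP; split=> //; exists v; rewrite // adj_sym.
move=> x; rewrite inE => /predU1P[->//|]; apply: IH pp vC _ x => z zp.
by apply: uN; rewrite inE zp orbT.
Qed.

(** A piece [C'] of [C] that sees no vertex of [Y] outside [S] stays growable: it trades [Y] for the
    smaller set [S], and the tokens move from [Y] to [S] along Menger paths. Minimality of [S]
    provides a path to each of its vertices. *)
Lemma cut_component k C C' X t Y Z S :
  nbhd C = X -> wf X t -> X \subset verts t -> [disjoint verts t & C] ->
  Y \subset X -> Z \subset X -> [disjoint Y & Z] -> k <= #|Y| -> #|S| < k ->
  separates (external C Y Z) Y Z S ->
  (forall R, separates (external C Y Z) Y Z R -> #|S| <= #|R|) ->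
  C' \subset C -> [disjoint C' & S] -> nbhd C' \subset X :|: S ->
  nbhd C' :&: Y \subset S ->
  #|nbhd C'| <= #|X| /\
  exists t', [/\ wf (nbhd C') t', nbhd C' \subset verts t'
               & [disjoint verts t' & C']].
Proof.
move=> NC wt Xt dt YX ZX dYZ kY ltSk sep minS sC' dS NC' NY.
have XC x : x \in X -> x \notin C by rewrite -NC => /nbhdP[].
split.
  have sN : nbhd C' \subset (X :\: Y) :|: S.
    apply/subsetP=> x xN; rewrite !inE; case: (boolP (x \in Y)) => xY /=.
      by rewrite (subsetP NY) // inE xN.
    by have := subsetP NC' x xN; rewrite inE.
  apply: leq_trans (subset_leq_card sN) _.
  apply: leq_trans (leq_card_setU _ _) _; rewrite cardsD (setIidPr YX).
  by have := subset_leq_card YX; lia.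
(* Cutting a path from [Y] to [Z] at its first vertex in [S] shows that [R] separates [Y] from [Z]
   too. *)
have minS' R : separates (external C Y Z) Y S R -> #|S| <= #|R|.
  move=> sepR; apply: minS => y p yY pp lZ.
  have [q [r [E lq _]]] := path_to_hit pp (sep _ _ yY pp lZ).
  move: pp; rewrite E cat_path => /andP[pq _].
  by rewrite -cat_cons has_cat (sepR y q).
have [S' [f [g [S'S cS' lnk]]]] := menger minS'.
have {S' S'S cS'}lnk : linkage (external C Y Z) Y S f g.
  by rewrite -(_ : S' = S) //; apply/eqP; rewrite eqEcard S'S cS' /=.
have lnkP s : s \in S :&: C -> [/\ f s \in Y, path (external C Y Z) (f s) (g s),
    last (f s) (g s) = s, uniq (f s :: g s) & {subset g s <= C}].
  case/setIP=> sS sC; have [fY fp fl fu] := lnk.1 s sS; split=> //.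
  apply: (external_path_sub dYZ fp); rewrite ?fl //.
  by apply: contraTneq sC => E; move: fl; rewrite E /= => <-; apply: XC;
    apply: (subsetP YX).
have self s : s \in S -> s \in f s :: g s.
  by move=> sS; have [_ _ fl _] := lnk.1 s sS; rewrite -{1}fl mem_last.
have gself s : s \in S :&: C -> s \in g s.
  move=> sSC; have [fY _ _ _ _] := lnkP s sSC; case/setIP: sSC => sS sC.
  have := self s sS; rewrite inE => /predU1P[E|//].
  by move: sC; rewrite E (negbTE (XC _ (subsetP YX _ fY))).
have onlyS s x : s \in S -> x \in S -> x \in f s :: g s -> x = s.
  by move=> sS xS xs; apply: (lnk.2 x s xS sS x) => //; apply: self.
have inL s : (s \in enum (S :&: C)) = (s \in S :&: C) by rewrite mem_enum.
have [|||t' [vt' wt']] :=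
    @move_tokens_along X t (enum (S :&: C)) f g wt Xt (enum_uniq _).
- move=> s; rewrite inL => /lnkP[fY fp fl fu gC]; split=> //.
  + exact: (subsetP YX).
  + exact: sub_path (@external_adj _ _ _ _) _ _ fp.
  + by case/andP: fu.
  + by move=> x /gC xC; rewrite (disjointFl dt xC).
- by move=> s; rewrite inL => /gself.
- move=> s s'; rewrite !inL => /setIP[sS _] /setIP[s'S _]; exact: lnk.2.
(* A vertex of [S] outside [C] ends a Menger path, so it lies in [Y] if that path is trivial and in
   [Z] otherwise. It needs no new token. *)
have XN x : x \in nbhd C' -> x \in X \/ x \in S :&: C.
  move=> xN; case/setUP: (subsetP NC' x xN) => [|xS]; first by left.
  case: (boolP (x \in C)) => xC; first by right; rewrite inE xS.
  left; have [fY fp fl _] := lnk.1 x xS.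
  case: (g x) fp fl => [_ /= E|v q]; first by rewrite -E (subsetP YX).
  elim: q (f x) v {fY} => [|w q IH] y v /=.
    case/andP=> /and4P[_ _ vZC _] _ E; move: vZC;
      rewrite E inE (negbTE xC) orbF.
    exact: (subsetP ZX).
  by case/andP=> _ pp E; apply: (IH v w).
(* No token that is still needed has moved: [f s] in [nbhd C'] would be in [S], hence equal to [s],
   but [s] is in [C] and [f s] is not. *)
have fN s : s \in S :&: C -> f s \notin nbhd C'.
  move=> sSC; have [fY _ _ _ _] := lnkP s sSC; case/setIP: sSC => sS sC.
  apply/negP=> fN; have fS : f s \in S by apply: (subsetP NY); rewrite inE fN.
  have E := onlyS _ _ sS fS (mem_head _ _).
  by move: sC; rewrite -E (negbTE (XC _ (subsetP YX _ fY))).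
exists t'; split.
- apply: wf_sub wt' => x _ xN; rewrite !inE mem_enum.
  case: (XN x xN) => [xX|->]; last by rewrite orbT.
  rewrite xX /=; apply/orP; left; apply/negP=> /mapP[s];
    rewrite inL => /fN fsN E.
  by rewrite -E xN in fsN.
- apply/subsetP=> x /XN[xX|xSC]; rewrite vt'; first by rewrite (subsetP Xt).
  by apply/orP; right; apply/hasP; exists x; rewrite ?inL ?gself.
apply/pred0P=> x /=; apply/negP=> /andP[]; rewrite vt' => /orP[xt|] xC'.
  by move: (subsetP sC' _ xC'); rewrite (disjointFr dt xt).
case/hasP: xC' => s; rewrite inL => sSC xg; apply/negP.
have [fY fp fl fu gC] := lnkP s sSC; have [sS sC] := setIP sSC.
(* A vertex of [nbhd C'] before the end of the path would be in [S], but [s] is the only vertex of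
   [S] there. *)
apply: (path_avoids (sub_path (@external_adj _ _ _ _) fp)) xg.
  by apply: contra (XC _ (subsetP YX _ fY)) => /(subsetP sC').
move=> z zb; apply/negP=> zN.
have zp : z \in f s :: g s by apply: mem_belast.
have zS : z \in S.
  move: (zp); rewrite inE => /predU1P[E|/gC zC].
    by rewrite E in zN; rewrite (negbTE (fN s sSC)) in zN.
  by case: (XN z zN) => [/XC|/setIP[]//]; rewrite zC.
have E := onlyS _ _ sS zS zp.
rewrite E in zb; by move: fu; rewrite lastI fl rcons_uniq zb.
Qed.

End Tokens.

(** * Tree-decompositions *)

Section ParentTree.
Variables (n : nat) (par : nat -> nat).
Hypothesis ltpar : forall i, 0 < i <= n -> par i < i.

(** The tree on the numbers up to [n], rooted at 0. As [par] acts on all of [nat], it keeps its type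
    when [n] grows. *)
Definition parent_adj (i j : 'I_n.+1) : bool :=
  (i < j) && (par j == i) || (j < i) && (par i == j).

Lemma parent_adj_sym : symmetric parent_adj.
Proof. by move=> i j; rewrite /parent_adj orbC. Qed.

Lemma parent_adj_irrefl : irreflexive parent_adj.
Proof. by move=> i; rewrite /parent_adj ltnn. Qed.

Definition parent_graph : sgraph := SGraph parent_adj_sym parent_adj_irrefl.

(** Passing to parents decreases the index and stays in [A], so it ends at [m]. *)
Lemma parent_connected (A : {set parent_graph}) (m : parent_graph) : m \in A ->
  {in A, forall d : 'I_n.+1, d != m ->
     0 < d /\ exists2 d' : 'I_n.+1, d' \in A & d' = par d :> nat} ->
  connected_in A.
Proof.
move=> mA parA; apply: (@star_connected _ _ m) => d.
have [b] := ubnP (d : 'I_n.+1); elim: b d => // b IH d ltd dA.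
have [->|dm] := eqVneq d m; first exact: connect0.
have [d0 [d' d'A E]] := parA d dA dm.
have lt_d' : (d' : 'I_n.+1) < (d : 'I_n.+1).
  by rewrite E ltpar // d0 -ltnS ltn_ord.
apply: connect_trans (IH d' (leq_trans lt_d' _) d'A) _; first by rewrite -ltnS.
by apply: linked_in_adj => //; rewrite /= /parent_adj lt_d' E eqxx.
Qed.

(* The two neighbours on a cycle of its largest vertex are its parent. *)
Lemma parent_acyclic : acyclic parent_graph.
Proof.
move=> c /andP[cc uc]; case: c cc uc => // x0 c0 cc uc.
have [i ic maxi] : exists2 i : 'I_n.+1, i \in x0 :: c0
    & forall j : 'I_n.+1, j \in x0 :: c0 -> j <= i.
  case: (@arg_maxnP _ x0 (fun j => j \in x0 :: c0) (fun j : 'I_n.+1 => j : nat)).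
    exact: mem_head.
  by move=> i ic maxi; exists i.
have [r q E] := rot_to ic.
have cq : cycle parent_adj (i :: q) by rewrite -E rot_cycle.
have uq : uniq (i :: q) by rewrite -E rot_uniq.
have maxq (j : 'I_n.+1) : j \in q -> j < i.
  move=> jq; have /maxi leji : j \in x0 :: c0.
    by rewrite -(mem_rot r) E inE jq orbT.
  rewrite ltn_neqAle leji andbT.
  by apply: contraTneq jq => /val_inj->; case/andP: uq.
rewrite -(size_rot r) E.
case: q cq uq maxq {E} => // a q cq /= /and3P[_ aq _] maxq.
move: cq; rewrite /= rcons_path => /and3P[ia _ li].
have lta : a < i by apply: maxq; apply: mem_head.
have ltl : last a q < i by apply: maxq; apply: mem_last.
have par_max (j : 'I_n.+1) : j < i -> parent_adj j i -> par i = j.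
  move=> ltji; rewrite /parent_adj ltji [i < j]ltnNge (ltnW ltji) orbF /=.
  by move/eqP.
have pa := par_max a lta; rewrite parent_adj_sym in pa.
have {ia}pa := pa ia; have pl := par_max _ ltl li.
have : last a q = a by apply: val_inj; exact: etrans (esym pl) pa.
by case: q aq {maxq ltl pl li} => //= b q aq E; case/negP: aq;
  rewrite -{1}E mem_last.
Qed.

Lemma parent_tree : is_tree parent_graph.
Proof.
split; first by rewrite card_ord.
  apply: (@parent_connected _ ord0); first by rewrite inE.
  move=> d _ d0; have d_gt0 : 0 < (d : 'I_n.+1) by rewrite lt0n.
  split=> //; have lt_n : par (d : 'I_n.+1) < n.+1.
    by apply: ltn_trans (ltpar _) (ltn_ord d); rewrite d_gt0 -ltnS ltn_ord.
  by exists (Ordinal lt_n); rewrite ?inE.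
exact: parent_acyclic.
Qed.

End ParentTree.

(** * Partial tree-decompositions and the choice of the next bag *)

Section PartialDecomposition.
Variables (G : sgraph) (h w : nat).
Implicit Types (C U B S : {set G}) (bag : nat -> {set G}) (par : nat -> nat).

Definition growable C : Prop :=
  #|nbhd C| <= h /\
  exists t, [/\ wf (nbhd C) t, nbhd C \subset verts t & [disjoint verts t & C]].

Definition covered n bag : {set G} := \bigcup_(i < n.+1) bag i.

Lemma coveredP n bag v :
  reflect (exists2 i, i <= n & v \in bag i) (v \in covered n bag).
Proof.
apply: (iffP bigcupP) => [[i _ vi]|[i lei vi]].
  by exists i; rewrite // -ltnS.
by rewrite -ltnS in lei; exists (Ordinal lei).
Qed.

(** The clause [pd_top] makes the bags containing a given vertex connected, in a form that is easy
    to keep when a last bag is added. The bound [w] is on the size of bags, one more than on the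
    width. *)
Record partial_decomposition n bag par : Prop := PartialDecomposition {
  pd_par : forall i, 0 < i <= n -> par i < i;
  pd_top : forall i j v, 0 < i <= n -> j < i -> v \in bag j -> v \in bag i ->
    v \in bag (par i);
  pd_size : forall i, i <= n -> #|bag i| <= w;
  pd_edge : forall u v, u \in covered n bag -> v \in covered n bag -> adj u v ->
    exists2 i, i <= n & (u \in bag i) && (v \in bag i);
  pd_component : forall C, component (covered n bag) C ->
    growable C /\ exists2 i, i <= n & nbhd C \subset bag i }.

Lemma decomposition_width n bag par : partial_decomposition n bag par ->
  covered n bag = [set: G] ->
  exists2 w', has_tree_decomposition_of_width G w' & w' <= w.-1.
Proof.
case=> ltpar top size edge _ full.
pose D := parent_graph n par; pose bagD (d : D) := bag (d : 'I_n.+1).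
have cov v : v \in covered n bag by rewrite full inE.
exists (width bagD); last first.
  rewrite /width -!subn1 leq_sub2r //; apply/bigmax_leqP => d _.
  by apply: size; rewrite -ltnS ltn_ord.
exists D, bagD; split=> //; split.
- exact: parent_tree.
- move=> v; have /coveredP[i lei vi] := cov v.
  by rewrite -ltnS in lei; exists (Ordinal lei).
- move=> u v uv; have [i lei uvi] := edge u v (cov u) (cov v) uv.
  by rewrite -ltnS in lei; exists (Ordinal lei).
move=> v; have /coveredP[i0 lei0 vi0] := cov v; rewrite -ltnS in lei0.
(* For any later bag containing [v], the first such bag is the earlier one required by [pd_top]. *)
case: (@arg_minnP _ (Ordinal lei0) (fun i : 'I_n.+1 => v \in bag i)
  (fun i : 'I_n.+1 => i : nat) vi0) => m vm minm.
apply: (parent_connected ltpar (m := m)); first by rewrite inE.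
move=> d; rewrite inE => vd dm.
have lt_md : m < d by rewrite ltn_neqAle eq_sym dm minm.
have d0 : 0 < d by apply: leq_trans lt_md.
have dn : 0 < d <= n by rewrite d0 -ltnS ltn_ord.
split=> //;
  have lt_n : par d < n.+1 by apply: ltn_trans (ltpar _ dn) (ltn_ord d).
exists (Ordinal lt_n) => //; rewrite inE; exact: (top d m v dn lt_md vm vd).
Qed.

(** A neighbour of [C'] in [U] is outside [C], so it is a neighbour of [C]. *)
Lemma nbhd_extend U B C C' : component U C -> component (U :|: B) C' ->
  C' \subset C -> nbhd C \subset B -> nbhd C' \subset B.
Proof.
move=> [_ _ dCU _] [_ _ _ NU'] sC NB; apply/subsetP=> v vN.
case/setUP: (subsetP NU' v vN) => // vU; apply: (subsetP NB).
have [_ [u uC' uv]] := nbhdP _ _ vN.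
by apply/nbhdP; split; [rewrite (disjointFl dCU) | exists u => //;
  apply: (subsetP sC)].
Qed.

(** The bag [B] is attached to a bag [j0] containing [nbhd C]. This works since [B] meets the
    covered set only in [nbhd C]. *)
Lemma extend_decomposition n bag par C B :
  partial_decomposition n bag par -> component (covered n bag) C ->
  B \subset C :|: nbhd C -> nbhd C \subset B -> #|B| <= w ->
  (forall C', component (covered n bag :|: B) C' -> C' \subset C -> growable C') ->
  exists bag' par', partial_decomposition n.+1 bag' par' /\
    covered n.+1 bag' = covered n bag :|: B.
Proof.
move=> pd cC BC NB cB growC'; have [ltpar top size edge comp] := pd.
have [grC [j0 lej0 Nj0]] := comp C cC.
set U := covered n bag in cC growC' edge comp *.
have [_ _ dCU NU] := cC.
pose bag' i := if i == n.+1 then B else bag i.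
pose par' i := if i == n.+1 then j0 else par i.
have bagE i : i <= n -> bag' i = bag i by rewrite /bag' => lei; rewrite ltn_eqF.
have bagB : bag' n.+1 = B by rewrite /bag' eqxx.
have parE i : i <= n -> par' i = par i by rewrite /par' => lei; rewrite ltn_eqF.
have UE : covered n.+1 bag' = U :|: B.
  rewrite /covered big_ord_recr /= bagB; congr (_ :|: _).
  by apply: eq_bigr => i _; rewrite bagE // -ltnS.
have BU v : v \in B -> v \in U -> v \in nbhd C.
  by move=> vB vU; case/setUP: (subsetP BC v vB) => // vC;
    rewrite (disjointFr dCU vC) in vU.
have inU i v : i <= n -> v \in bag i -> v \in U.
  by move=> lei vi; apply/coveredP; exists i.
exists bag', par'; split=> //; split.
- move=> i /andP[i0]; rewrite leq_eqVlt => /predU1P[->|lei].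
    by rewrite /par' eqxx.
  by rewrite parE // ltpar // i0.
- move=> i j v /andP[i0]; rewrite leq_eqVlt => /predU1P[->|lei].
    rewrite bagB {1}/par' eqxx ltnS => lej; rewrite !bagE // => vj vB.
    by apply: (subsetP Nj0); apply: BU => //; apply: inU vj.
  have ip : 0 < i <= n by rewrite i0.
  move=> ltj; rewrite parE // !bagE //; first exact: top.
    by apply: leq_trans (ltnW (ltpar _ ip)) _.
  by apply: leq_trans (ltnW ltj) _.
- move=> i; rewrite leq_eqVlt => /predU1P[->|lei]; first by rewrite bagB.
  by rewrite bagE // size.
- rewrite UE => u v.
  (* If [x] were in [C], then [y] would be in [nbhd C], hence in [B]. So an edge not inside [B] has
     both ends in [U] and lies in an old bag. *)
  have key x y : x \in B -> y \in U -> y \notin B -> adj x y -> x \in U.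
    move=> xB yU yB xy; case/setUP: (subsetP BC x xB) => [xC|/(subsetP NU)//].
    case/negP: yB; apply: (subsetP NB); apply/nbhdP.
    by split; [rewrite (disjointFl dCU) | exists x].
  move=> uUB vUB uv.
  case: (boolP ((u \in B) && (v \in B))) => [uvB|nB].
    by exists n.+1; rewrite ?bagB.
  have uU : u \in U.
    case/setUP: uUB => // uB; move: nB; rewrite uB /= => vB.
    by case/setUP: vUB => [vU|]; [apply: key uB vU vB uv | rewrite (negbTE vB)].
  have vU : v \in U.
    case/setUP: vUB => // vB; move: nB; rewrite vB andbT => uB.
    by apply: key vB uU uB _; rewrite adj_sym.
  have [i lei uvi] := edge u v uU vU uv.
  by exists i; rewrite ?bagE // ltnW.
- rewrite UE => C' cC'; case: (component_extend cC BC cC') => [old|sC].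
    have [gr [i lei Ni]] := comp C' old; split=> //.
    by exists i; rewrite ?bagE // ltnW.
  split; first exact: growC'.
  by exists n.+1; rewrite ?bagB // (nbhd_extend cC cC' sC NB).
Qed.

Lemma exists_min_separator (T : finType) (e : rel T) (A A' : {set T}) :
  exists2 S, separates e A A' S & forall R, separates e A A' R -> #|S| <= #|R|.
Proof.
have ex : exists m, `[< exists2 S, separates e A A' S & #|S| = m >].
  exists #|[set: T]|; apply/asboolP; exists [set: T] => // a p _ _ _.
  by apply/hasP; exists a; rewrite ?mem_head ?inE.
case: (ex_minnP ex) => m /asboolP[S sep cS] minm.
exists S => // R sepR; rewrite cS; apply: minm.
by apply/asboolP; exists R.
Qed.

Lemma grow_small U C : component U C -> growable C -> #|nbhd C| < h ->
  h <= w ->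
  exists B, [/\ B \subset C :|: nbhd C, nbhd C \subset B, #|B| <= w,
    ~~ [disjoint B & C]
  & forall C', component (U :|: B) C' -> C' \subset C -> growable C'].
Proof.
move=> cC [_ [t [wt Nt dt]]] lth hw; have [C0 _ dCU _] := cC.
have [v [t' [vC wt' vt' Nt' st']]] : exists v t', [/\ v \in C,
    wf (v |: nbhd C) t', v \in verts t', nbhd C \subset verts t'
    & verts t' \subset v |: verts t].
  (* Disjointness means that [nbhd C] is empty, and then a new tree with one vertex is started.
     Otherwise [v] is a neighbour in [C] of a token that can be duplicated. *)
  case: (boolP [disjoint nbhd C & verts t]) => [|/(branch_token wt)].
    rewrite -setI_eq0 (setIidPl Nt) => /eqP N0.
    case/set0Pn: C0 => v vC; exists v, (Node v (Empty G) (Empty G)).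
    rewrite N0 sub0set wf_leaf /= !setU0 set11; split=> //.
    by rewrite sub1set setU11.
  case=> x /setIP[xN xt] grow; have [_ [v vC vx]] := nbhdP _ _ xN.
  have vt : v \notin verts t by rewrite (disjointFl dt).
  have [t' [_ st' Nt' wt']] := grow v vt (etrans (adj_sym _ _) vx).
  exists v, t'; rewrite (setIidPl Nt) in Nt'; split=> //.
    by apply: (subsetP Nt'); apply: setU11.
  by apply: subset_trans Nt'; apply: subsetUr.
have cB : #|v |: nbhd C| <= h.
  by rewrite cardsU1; apply: leq_trans lth; rewrite -add1n leq_add2r leq_b1.
exists (v |: nbhd C); split.
- by rewrite setSU // sub1set.
- exact: subsetUr.
- exact: leq_trans hw.
- by apply/pred0Pn; exists v; rewrite /= setU11.
move=> C' cC' sC; have NB := nbhd_extend cC cC' sC (subsetUr _ _).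
have [_ _ dC' _] := cC'.
split; first by apply: leq_trans cB; apply: subset_leq_card.
exists t'; split.
- by apply: wf_sub wt' => x _; apply: (subsetP NB).
- by apply: subset_trans NB _; rewrite subUset sub1set vt'.
apply: disjointWl st' _;
  rewrite disjoints_subset subUset sub1set -disjoints_subset.
rewrite (disjointWr sC dt) andbT inE (disjointFl dC') //.
by rewrite !inE eqxx orbT.
Qed.

(** The tree is split into [p] blocks. Either their contraction gives the desired minor, or fewer
    than [k] vertices separate two blocks through [C], and those in [C] are added to [nbhd C]. *)
Lemma grow_large k p U C : component U C -> growable C ->
  1 < k -> k <= p -> 2 * (k - 1) * (p - 1) + (k - 1) < #|nbhd C| ->
  h + (k - 1) <= w ->
  (exists H : sgraph, minor H G /\
    exists X : {set H}, [/\ #|X| = p, independent X & inseparable k X]) \/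
  exists B, [/\ B \subset C :|: nbhd C, nbhd C \subset B, #|B| <= w,
    ~~ [disjoint B & C]
  & forall C', component (U :|: B) C' -> C' \subset C -> growable C'].
Proof.
move=> cC [leNh [t [wt Nt dt]]] k1 kp ltN hw; have [C0 cnC dCU _] := cC.
have [P [Pt cP kP dP]] := split_blocks k1 wt Nt ltN.
have P0 i : P i != set0.
  by apply: contraTneq (kP i) => ->; rewrite set0I cards0 -ltnNge ltnW.
have PC i : [disjoint P i & C] by apply: disjointWl (Pt i) dt.
case: (inseparable_or_separator (nbhd C) kp PC dP) => [HX|].
  by left; exists (mesh_graph C P); split=> //; apply: mesh_graph_minor.
case=> i [j [S0 [ij ltS0 sepS0]]]; right.
set Y := P i :&: nbhd C in sepS0 *; set Z := P j :&: nbhd C in sepS0 *.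
have dYZ : [disjoint Y & Z].
  by apply: disjointWl (subsetIl _ _) _;
    apply: disjointWr (subsetIl _ _) (dP i j ij).
have YN : Y \subset nbhd C by apply: subsetIr.
have ZN : Z \subset nbhd C by apply: subsetIr.
have [S sep minS] := exists_min_separator (external C Y Z) Y Z.
have ltSk : #|S| < k := leq_ltn_trans (minS _ sepS0) ltS0.
have sep' := separates_external_sym sep.
have minS' R : separates (external C Z Y) Z Y R -> #|S| <= #|R|.
  by move/separates_external_sym; apply: minS.
have outS (A : {set G}) : k <= #|A| -> exists2 x, x \in A & x \notin S.
  move=> kA; apply/subsetPn; apply/negP=> /subset_leq_card leAS.
  by move: (leq_trans kA leAS); rewrite leqNgt ltSk.
exists (nbhd C :|: S :&: C); split.
- by rewrite setUC setSU // subsetIr.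
- exact: subsetUl.
- apply: leq_trans (leq_card_setU _ _) _; apply: leq_trans hw;
  apply: leq_add => //.
  by have := subset_leq_card (subsetIl S C); lia.
(* The new bag meets [C]: if [S] missed [C], then [C] would connect vertices of [Y] and [Z] outside
   [S]. *)
- have [y yY yS] := outS Y (kP i); have [z zZ zS] := outS Z (kP j).
  apply/negP=> dis; case/negP: zS.
  apply: (connected_one_side (subxx C) cnC _ sep yY _ yS zZ).
  + rewrite disjoint_sym -setI_eq0 -subset0; apply/subsetP=> x xSC.
    by rewrite -(disjoint_setI0 dis) inE (setIP xSC).2 andbT inE xSC orbT.
  + exact: (subsetP YN).
  + exact: (subsetP ZN).
move=> C' cC' sC; have [_ cnC' dC' _] := cC'.
have NB := nbhd_extend cC cC' sC (subsetUl _ _).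
have NXS : nbhd C' \subset nbhd C :|: S.
  by apply: subset_trans NB _; rewrite setUS // subsetIl.
have dC'S : [disjoint C' & S].
  apply/pred0P=> x /=; apply/negP=> /andP[xC' xS].
  by move: (disjointFr dC' xC'); rewrite !inE xS (subsetP sC) // !orbT.
suff [] : #|nbhd C'| <= #|nbhd C| /\
    exists t', [/\ wf (nbhd C') t', nbhd C' \subset verts t'
      & [disjoint verts t' & C']].
  by move=> leN t'; split=> //; apply: leq_trans leNh.
(* Outside [S], [C'] sees at most one of [Y] and [Z]; the tokens of the other one are moved. *)
case: (boolP (nbhd C' :&: Y \subset S)) => NY.
  exact: (cut_component (k := k) erefl wt Nt dt YN ZN dYZ (kP i) ltSk sep minS sC).
apply: (cut_component (k := k) erefl wt Nt dt ZN YN _ (kP j) ltSk sep' minS' sC) => //.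
  by rewrite disjoint_sym.
case/subsetPn: NY => y /setIP[yN yY] yS.
apply/subsetP=> z /setIP[zN zZ].
exact: (connected_one_side sC cnC' dC'S sep yY yN yS zZ).
Qed.

End PartialDecomposition.

Theorem theorem6p3 (G : sgraph) (k p : nat) (hk : 2 <= k) (hp : k <= p)
    (htw : 2 * (k - 1) * (p + 1) <= treewidth G) :
  exists H : sgraph, minor H G /\
    exists X : {set H}, [/\ #|X| = p, independent X & inseparable k X].
Proof.
(* [h] is the least size of a neighbourhood for which [split_blocks] yields [p] blocks. A bag
   consists of at most [h] such vertices and at most [k - 1] separating ones. *)
pose h := 2 * (k - 1) * (p - 1) + k; pose w := h + (k - 1).
apply: contrapT => noH.
suff [n [bag [par [pd full]]]] : exists n bag par,
    partial_decomposition (G := G) h w n bag par /\ covered n bag = [set: G].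
  have [w' Dw' lew'] := decomposition_width pd full.
  move: htw; rewrite /treewidth; case: ex_minnP => tw _ mintw; rewrite leqNgt.
  case/negP; apply: leq_ltn_trans (mintw w' _) _; first exact/asboolP.
  apply: leq_ltn_trans lew' _; rewrite /w /h.
  (* The assumed bound is [2 * (k - 1) * (p - 1) + 4 * (k - 1)], which exceeds [w - 1] by
     [2 * (k - 1)]. *)
  have -> : p + 1 = (p - 1) + 2 by lia.
  rewrite mulnDr; lia.
suff grow m : forall n bag par, partial_decomposition (G := G) h w n bag par ->
    #|~: covered n bag| < m -> exists n' bag' par',
    partial_decomposition (G := G) h w n' bag' par' /\ covered n' bag' = [set: G].
  apply: (grow #|~: covered 0 (fun=> set0 : {set G})|.+1 0 (fun=> set0) id) => //.
  (* The construction starts with one empty bag. Components then have no neighbours, and the empty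
     tree makes them growable. *)
  have E : covered 0 (fun=> set0 : {set G}) = set0 by rewrite /covered big1.
  split=> [[|i]|[|i]|i _|u v|C]; rewrite ?cards0 ?E ?inE //.
  case=> _ _ _; rewrite subset0 => /eqP N0; split; last by exists 0;
    rewrite ?N0.
  split; first by rewrite N0 cards0.
  by exists (Empty G); rewrite N0 sub0set /= disjoints_subset sub0set.
elim: m => // m IH n bag par pd lem.
have [full|nfull] := eqVneq (covered n bag) [set: G];
  first by exists n, bag, par.
have [v vU] : exists v, v \notin covered n bag.
  by move: nfull; rewrite -subTset => /subsetPn[v _]; exists v.
have [C cC] := exists_component vU.
have [grC _] := pd_component pd cC.
have [B [BC NB cB BnC growB]] : exists B : {set G}, [/\ B \subset C :|: nbhd C,
    nbhd C \subset B, #|B| <= w, ~~ [disjoint B & C] & forall C' : {set G},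
    component (covered n bag :|: B) C' -> C' \subset C -> growable h C'].
  case: (ltnP #|nbhd C| h) => leN.
    by apply: grow_small => //; apply: leq_addr.
  case: (grow_large (w := w) cC grC hk hp _ (leqnn _)) => //.
  by apply: leq_trans leN; rewrite /h; lia.
have [bag' [par' [pd' U']]] := extend_decomposition pd cC BC NB cB growB.
apply: (IH _ _ _ pd'); rewrite -ltnS; apply: leq_trans lem; rewrite ltnS U'.
(* Fewer vertices remain uncovered, because [B] meets [C]. *)
apply: proper_card; rewrite properC; apply/properP; split;
  first exact: subsetUl.
case/pred0Pn: BnC => x /= /andP[xB xC]; exists x; first by rewrite inE xB orbT.
by have [_ _ dCU _] := cC; rewrite (disjointFr dCU xC).
Qed.
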